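(* There are constants $\eta_{\sigma,\varrho}$ (depending only on a partition $\sigma$ and on $\varrho\in(0,1]$) and $\widetilde\eta_{n,\varrho}$ (depending only on $n$ and $\varrho$), with $0\le \eta_{\sigma,\varrho}<\widetilde\eta_{n,\varrho}<1$ for every partition $\sigma$ of $n$, such that the following holds. Let $\pi=(n_1,\ldots,n_m)$ be a partition of $n$ and let $\mathcal{O}\in\mathcal{B}_{spg}^{(m)}$. Then there is an appropriate permutation $\mathsf{q}$ of $\{1,\ldots,m\}$ (associated with $\mathcal O$) such that for every real symmetric matrix $A$ of order $n$, partitioned into blocks according to $\pi$, if $A'$ is obtained from $A$ by applying one sweep of the cyclic block Jacobi method defined by the strategy $I_{\mathcal{O}}$ and all transformation matrices are from the class $\mathrm{UBCE}_{\pi}(\varrho)$, then $$S^2(A')\leq \eta_{\pi_{\mathsf{q}},\varrho}\, S^2(A),\qquad 0\leq \eta_{\pi_{\mathsf{q}},\varrho}<\widetilde{\eta}_{n,\varrho}<1 .$$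
   Context: **Partitions and blocks.** A partition $\pi=(n_1,\ldots,n_m)$ of $n$ ($m\ge 2$) is a tuple of positive integers with $n_1+\cdots+n_m=n$ (order matters). An $n\times n$ matrix is viewed as a block matrix $A=(A_{rs})$ with $A_{rs}$ of size $n_r\times n_s$. For a permutation $\mathsf q$ of $\{1,\dots,m\}$, $\pi_{\mathsf q}=(n_{\mathsf q(1)},\ldots,n_{\mathsf q(m)})$. For symmetric $A=(a_{st})$, $S(A)=\big(\sum_{s<t}|a_{st}|^2\big)^{1/2}$ (sum over all strictly upper-triangular elements). **Elementary block matrices, UBCE.** For $1\le i<j\le m$ and $\widehat U=\begin{bmatrix} U_{ii} & U_{ij} \\ U_{ji} & U_{jj} \end{bmatrix}$ of order $n_i+n_j$, $\mathcal E(i,j,\widehat U)$ is the $n\times n$ matrix equal to $I_n$ except that its blocks at positions $(i,i),(i,j),(j,i),(j,j)$ are $U_{ii},U_{ij},U_{ji},U_{jj}$; $(i,j)$ is its pivot pair. For $0<\varrho\le1$, an orthogonal elementary block matrix $\mathcal E(i,j,\widehat U)$ is in $\mathrm{UBCE}_\pi(\varrho)$ if $\sigma_{\min}(U_{ii})=\sigma_{\min}(U_{jj})\ge\varrho\,\gamma_{ij}$, where $\gamma_{ij}=3/\sqrt{(4^{n_i}+6n_j-1)(n_j+1)}$. **Pivot sequences.** $\mathcal P_m=\{(r,s):1\le r<s\le m\}$, $M=m(m-1)/2$. $\mathbf O(\mathcal P_m)$ is the set of finite sequences of elements of $\mathcal P_m$ containing every element at least once; those of length $M$ are orderings of $\mathcal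 P_m$. For $\mathcal O=(i_0,j_0),\ldots,(i_{T-1},j_{T-1})$, $I_{\mathcal O}$ is the $T$-periodic strategy with $I_{\mathcal O}(k)=(i_{k\bmod T},j_{k\bmod T})$. **Block Jacobi method.** $A^{(0)}=A$, $A^{(k+1)}=U_k^TA^{(k)}U_k$, where $U_k$ is an orthogonal elementary block matrix with pivot pair $(i,j)=I_{\mathcal O}(k)$ such that the pivot submatrix $\begin{bmatrix} A_{ii} & A_{ij} \\ A_{ji} & A_{jj} \end{bmatrix}$ of $A^{(k+1)}$ is diagonal. One sweep consists of $T$ steps ($T=M$ in the cyclic case). **Equivalences.** $\mathcal O\sim\mathcal O'$: one is obtained from the other by finitely many transpositions of adjacent terms $(i_r,j_r),(i_{r+1},j_{r+1})$ with $\{i_r,j_r\}\cap\{i_{r+1},j_{r+1}\}=\emptyset$. $\mathcal O(\mathsf q)=(\mathsf q(i_0),\mathsf q(j_0)),\ldots$, where a pair $(a,b)$ with $a>b$ is replaced by $(b,a)$; $\mathcal O'\stackrel{\mathsf p}{\sim}\mathcal O$ if $\mathcal O'=\mathcal O(\mathsf q)$ for some permutation $\mathsf q$ of $\{1,\ldots,m\}$. $\mathcal O^{\leftarrow}$ is $\mathcal O$ written in reverse order. **Classes of orderings.** $\mathcal B_c^{(m)}$: orderings $(1,2),(\tau_3(1),3),(\tau_3(2),3),\ldots,(\tau_m(1),m),\ldots,(\tau_m(m-1),m)$ with $\tau_j$ a permutation of $\{1,\ldots,j-1\}$. $\mathcal B_r^{(m)}$: orderings $(m-1,m),(m-2,\widetilde\tau_{m-2}(m-1)),(m-2,\widetilde\tau_{m-2}(m)),\ldots,(1,\widetilde\tau_1(2)),\ldots,(1,\widetilde\tau_1(m))$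 with $\widetilde\tau_i$ a permutation of $\{i+1,\ldots,m\}$. $\mathcal B_{sp}^{(m)}=\{\mathcal O:\ \mathcal O\text{ or }\mathcal O^{\leftarrow}\in\mathcal B_c^{(m)}\cup\mathcal B_r^{(m)}\}$. $\mathcal B_{spg}^{(m)}$ is the set of $\mathcal O\in\mathbf O(\mathcal P_m)$ such that, for some $\mathcal O'\in\mathbf O(\mathcal P_m)$ and $\mathcal O''\in\mathcal B_{sp}^{(m)}$, either $\mathcal O\stackrel{\mathsf p}{\sim}\mathcal O'\sim\mathcal O''$ or $\mathcal O\sim\mathcal O'\stackrel{\mathsf p}{\sim}\mathcal O''$. *)

(* Defs.v *)
From Stdlib Require Export Relation_Operators.
From mathcomp Require Export all_boot all_order all_algebra all_fingroup.
From mathcomp Require Export classical_sets reals.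

Set Implicit Arguments.
Unset Strict Implicit.
Unset Printing Implicit Defensive.

Import Order.TTheory GRing.Theory Num.Theory.

Local Open Scope ring_scope.

(* Block indices are 0-based: the source's {1, ..., m} is 'I_m.               *)

Definition is_partition (n m : nat) (p : m.-tuple nat) : Prop :=
  [/\ (1 < m)%N, forall i, (0 < tnth p i)%N & (\sum_i tnth p i)%N = n].

Definition perm_partition (m : nat) (p : m.-tuple nat) (q : 'S_m) :
    m.-tuple nat :=
  [tuple tnth p (q i) | i < m].

Definition offnorm (R : realType) (n : nat) (A : 'M[R]_n) : R :=
  Num.sqrt (\sum_(s < n) \sum_(t < n | (s < t)%N) `|A s t| ^+ 2).

Definition singular_value (R : realType) (n : nat) (B : 'M[R]_n) (s : R) :
    Prop :=
  0 <= s /\ eigenvalue (B^T *m B) (s ^+ 2).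

(* For n > 0 the set is finite and nonempty, so the infimum is a minimum.     *)
Definition sigma_min (R : realType) (n : nat) (B : 'M[R]_n) : R :=
  inf [set s | singular_value B s]%classic.

(* When (r, s) is one of the four pivot positions, the corresponding block of *)
(* U has the dimensions of the (r, s) block and conform_mx selects it; its    *)
(* first argument only serves to make the expression well typed.              *)
Definition elementary_block (R : realType) (m : nat) (p : 'I_m -> nat)
    (i j : 'I_m) (U : 'M[R]_(p i + p j)) : 'M[R]_(\sum_i p i) :=
  \mxblock_(r, s)
    let I_rs : 'M[R]_(p r, p s) := submxblock 1%:M r s in
    if (r == i) && (s == i) then conform_mx I_rs (ulsubmx U)
    else if (r == i) && (s == j) then conform_mx I_rs (ursubmx U)
    else if (r == j) && (s == i) then conform_mx I_rs (dlsubmx U)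
    else if (r == j) && (s == j) then conform_mx I_rs (drsubmx U)
    else I_rs.

Definition gamma (R : realType) (ni nj : nat) : R :=
  3 / Num.sqrt ((4 ^+ ni + 6 * nj%:R - 1) * (nj%:R + 1)).

(* Membership in UBCE, relative to the pivot pair (i, j).                     *)
Definition UBCE (R : realType) (m : nat) (p : 'I_m -> nat) (rho : R)
    (i j : 'I_m) (V : 'M[R]_(\sum_i p i)) : Prop :=
  (i < j)%N /\
  exists U : 'M[R]_(p i + p j),
    [/\ V = elementary_block U,
        V^T *m V = 1%:M,
        sigma_min (ulsubmx U) = sigma_min (drsubmx U) &
        rho * gamma R (p i) (p j) <= sigma_min (ulsubmx U)].

Definition pivot_submx (R : realType) (m : nat) (p : 'I_m -> nat)
    (A : 'M[R]_(\sum_i p i)) (i j : 'I_m) : 'M[R]_(p i + p j) :=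
  block_mx (submxblock A i i) (submxblock A i j)
           (submxblock A j i) (submxblock A j j).

Definition pivot_sequence (m : nat) (O : seq ('I_m * 'I_m)) : bool :=
  all (fun x : 'I_m * 'I_m => (x.1 < x.2)%N) O &&
  [forall i : 'I_m, forall j : 'I_m, (i < j)%N ==> ((i, j) \in O)].

(* The periodic strategy I_O; its value is Some _ for all k when O is         *)
(* nonempty.                                                                  *)
Definition strategy (m : nat) (O : seq ('I_m * 'I_m)) (k : nat) :
    option ('I_m * 'I_m) :=
  onth O (k %% size O)%N.

Definition jacobi_step (R : realType) (m : nat) (p : 'I_m -> nat) (rho : R)
    (i j : 'I_m) (A A' : 'M[R]_(\sum_i p i)) : Prop :=
  exists V : 'M[R]_(\sum_i p i),
    [/\ UBCE rho i j V, A' = V^T *m A *m V & is_diag_mx (pivot_submx A' i j)].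

Definition jacobi_sweep (R : realType) (m : nat) (p : 'I_m -> nat) (rho : R)
    (O : seq ('I_m * 'I_m)) (A A' : 'M[R]_(\sum_i p i)) : Prop :=
  exists X : nat -> 'M[R]_(\sum_i p i),
    [/\ X 0%N = A,
        forall k, (k < size O)%N ->
          exists i j, strategy O k = Some (i, j) /\
                      jacobi_step rho i j (X k) (X k.+1) &
        X (size O) = A'].

Definition admissible_transposition (m : nat) (O O' : seq ('I_m * 'I_m)) :
    Prop :=
  exists s1 x y s2,
    [/\ O = s1 ++ x :: y :: s2, O' = s1 ++ y :: x :: s2 &
        [set x.1; x.2] :&: [set y.1; y.2] = finset.set0].

Definition equiv_seq (m : nat) : seq ('I_m * 'I_m) -> seq ('I_m * 'I_m) -> Prop
  := clos_refl_trans _ (@admissible_transposition m).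

Definition relabel (m : nat) (q : 'S_m) (O : seq ('I_m * 'I_m)) :
    seq ('I_m * 'I_m) :=
  [seq if (q x.1 < q x.2)%N then (q x.1, q x.2) else (q x.2, q x.1) | x <- O].

Definition perm_equiv (m : nat) (O' O : seq ('I_m * 'I_m)) : Prop :=
  exists q : 'S_m, O' = relabel q O.

(* A permutation of a subset D of 'I_m is a permutation of 'I_m that is       *)
(* perm_on D. The columns j = 0, 1, 2, ... contribute 0, 1, 2, ... pairs.     *)
Definition Bc (m : nat) (O : seq ('I_m * 'I_m)) : Prop :=
  exists tau : 'I_m -> 'S_m,
    (forall j : 'I_m, perm_on [set i : 'I_m | (i < j)%N] (tau j)) /\
    O = flatten [seq [seq (tau j i, j) | i : 'I_m <- enum 'I_m & (i < j)%N]
                | j : 'I_m <- enum 'I_m].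

Definition Br (m : nat) (O : seq ('I_m * 'I_m)) : Prop :=
  exists tau : 'I_m -> 'S_m,
    (forall i : 'I_m, perm_on [set j : 'I_m | (i < j)%N] (tau i)) /\
    O = flatten [seq [seq (i, tau i j) | j : 'I_m <- enum 'I_m & (i < j)%N]
                | i : 'I_m <- rev (enum 'I_m)].

Definition Bsp (m : nat) (O : seq ('I_m * 'I_m)) : Prop :=
  (Bc O \/ Br O) \/ (Bc (rev O) \/ Br (rev O)).

Definition Bspg (m : nat) (O : seq ('I_m * 'I_m)) : Prop :=
  pivot_sequence O /\
  exists O' O'' : seq ('I_m * 'I_m),
    [/\ pivot_sequence O', Bsp O'' &
        (perm_equiv O O' /\ equiv_seq O' O'') \/
        (equiv_seq O O' /\ perm_equiv O' O'')].

(* Main.v *)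
Require Import Defs.
From mathcomp Require Import sesquilinear spectral complex.
From mathcomp Require Import zify ring lra.

(* A step with pivot (i, j) decreases S^2 by at least |A_ij|^2, so if D is the *)
(* total decrease over a sweep, every pivot block has norm^2 at most D before  *)
(* its annihilation and 0 after it. For a block A_rk of a column k that is     *)
(* still to be treated, a rotation of the pair (s, k) gives                    *)
(*     A'_rk = A_rs U_sk + A_rk U_kk,                                          *)
(* and since the singular values of U_kk are bounded below, |A_rk|^2 is        *)
(* bounded by a multiple of |A'_rk|^2 + |A_rs|^2. Running backwards from the   *)
(* annihilation of (r, k), and by induction on the columns, all off-diagonal   *)
(* blocks at the end of the sweep are O(D), hence S^2(A') = O(D), which is the *)
(* contraction. Reversed orderings follow by reading the sweep backwards in    *)
(* time (replacing U by U^T), row orderings by reversing the block indices,    *)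
(* and the equivalence of orderings because disjoint rotations commute.        *)

Set Implicit Arguments.
Unset Strict Implicit.
Unset Printing Implicit Defensive.

Import Order.TTheory GRing.Theory Num.Theory.

Local Open Scope ring_scope.

(** * Block rotations and the off-diagonal norm *)

(** The estimate has the form [offdiag_sum A' <= Q * (offdiag_sum A - offdiag_sum A')], with [Q]
    depending only on [n] and [rho]; solving for [offdiag_sum A'] gives the contraction factor
    [Q / (1 + Q)]. By [offdiag_sum_step], each step moves at least the squared norm of its pivot
    block onto the diagonal, so the total decrease controls all pivot blocks. By [column_bound] and
    [column_ordering_bound], the pivot blocks control every final block; the initial blocks may be
    arbitrarily large, since each block is estimated backwards from its own annihilation.

    The combinatorics takes place on the pivot list. A column ordering is defined over any list of
    distinct labels, so relabelling by a permutation and passing from columns to rows stay within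
    the notion ([column_ordering_map], [Br_column_ordering]). Transpositions of disjoint pairs are
    absorbed by [diagonalizing_step_comm], reversed lists by the symmetric relation
    [small_pivot_step]. The class UBCE enters through [UBCE_elementary_rotation], where the spectral
    theorem ([symmetric_rayleigh]) turns the bound on [sigma_min] into lower bounds for the diagonal
    blocks and their transposes. *)

Section Chain.
Variables (T M : Type).
Implicit Types (st : T * T -> M -> M -> Prop) (l : seq (T * T)).

(** A sweep as a composition of relations along the pivot list: splitting, reversing and reordering
    the sweep become list operations. *)
Fixpoint chain st l (A A' : M) : Prop :=
  if l is x :: l' then exists2 B, st x A B & chain st l' B A' else A = A'.

Lemma chain_cat st l1 l2 A A' :
  chain st (l1 ++ l2) A A' <-> exists2 B, chain st l1 A B & chain st l2 B A'.
Proof.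
elim: l1 A => [|x l1 IH] A /=.
  by split=> [|[_ <-]] // h; exists A.
split=> [[B hB /IH[C hC1 hC2]]|[C [B hB hC1] hC2]].
  by exists C => //; exists B.
by exists B => //; apply/IH; exists C.
Qed.

Lemma chain_rev st (sym : forall x A B, st x A B -> st x B A) l A A' :
  chain st l A A' -> chain st (rev l) A' A.
Proof.
elim: l A => [|x l IH] A /= => [->//|[B hB /IH hl]].
rewrite rev_cons -cats1; apply/chain_cat; exists B => //=.
by exists A => //; apply: sym.
Qed.

Lemma chain_map st (X : Type) (f f' : X -> T * T) (s : seq X)
    (hff' : forall x A B, st (f x) A B -> st (f' x) A B) A A' :
  chain st (map f s) A A' -> chain st (map f' s) A A'.
Proof.
elim: s A => [|x s IH] A //= [B hB hs].
by exists B; [apply: hff'|apply: IH].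
Qed.

Lemma chain_nth st l (X : nat -> M) :
  (forall k, (k < size l)%N ->
     exists2 x, onth l k = Some x & st x (X k) (X k.+1)) ->
  chain st l (X 0%N) (X (size l)).
Proof.
elim: l X => [|x l IH] X hX //=.
have [_ [<-] h0] := hX 0%N isT.
exists (X 1%N) => //.
apply: (IH (fun k => X k.+1)) => k hk.
exact: (hX k.+1).
Qed.

End Chain.

Section Flat.
Variables (R : realType) (N : nat) (T : eqType) (b : 'I_N -> T).
Implicit Types (A B C V W : 'M[R]_N) (i j k l r s : T) (g D : R).

(** Blocks are the fibres of the labelling [b], which avoids matrix types that depend on block
    sizes. *)
Definition in_pivot i j (u : 'I_N) := (b u == i) || (b u == j).

Definition blocknorm A r s : R :=
  \sum_(u | b u == r) \sum_(v | b v == s) A u v ^+ 2.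

(** For [x] supported on block [k], the right side is the squared norm of [x_k V_kk]; so [g] is a
    lower bound for the squared singular values of [V_kk]. *)
Definition bounded_below g k V := forall x : 'rV[R]_N,
  (forall u, b u != k -> x 0 u = 0) ->
  g * (\sum_(u | b u == k) x 0 u ^+ 2) <=
    \sum_(u | b u == k) (x *m V) 0 u ^+ 2.

(** The bounds are imposed on [V] and on [V^T], so that the class is closed under transposition,
    that is, under reversing a step in time. *)
Definition elementary_rotation g i j V := [/\ i != j, V^T *m V = 1%:M,
  forall u v, ~~ (in_pivot i j u && in_pivot i j v) -> V u v = (u == v)%:R,
  bounded_below g i V /\ bounded_below g j V &
  bounded_below g i V^T /\ bounded_below g j V^T].

Definition diagonalizing_step g (x : T * T) A A' := exists V,
  [/\ elementary_rotation g x.1 x.2 V, A' = V^T *m A *m V &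
      forall u v, u != v -> in_pivot x.1 x.2 u -> in_pivot x.1 x.2 v ->
        A' u v = 0].

Lemma in_pivotC i j u : in_pivot i j u = in_pivot j i u.
Proof. exact: orbC. Qed.

Lemma elementary_rotationC g i j V :
  elementary_rotation g i j V -> elementary_rotation g j i V.
Proof.
case=> nij oV eV [gi gj] [gi' gj']; split=> //; first by rewrite eq_sym.
by move=> u v; rewrite !(in_pivotC j); apply: eV.
Qed.

Lemma elementary_rotationT g i j V :
  elementary_rotation g i j V -> elementary_rotation g i j V^T.
Proof.
case=> nij oV eV gV gV'; split; rewrite ?trmxK //; first exact: mulmx1C.
by move=> u v; rewrite mxE andbC eq_sym; apply: eV.
Qed.

Lemma diagonalizing_stepC g i j A A' :
  diagonalizing_step g (i, j) A A' -> diagonalizing_step g (j, i) A A'.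
Proof.
move=> [V [/= /elementary_rotationC rV eA dA]]; exists V; split=> //= u v.
by rewrite !(in_pivotC j); apply: dA.
Qed.

(* Column [v] of [V] is a unit vector when [v] is outside the pivot blocks. *)
Lemma mulmx_rotation_out g i j V m (X : 'M[R]_(m, N)) w v :
  elementary_rotation g i j V -> ~~ in_pivot i j v -> (X *m V) w v = X w v.
Proof.
case=> _ _ eV _ _ nv; rewrite mxE (bigD1 v) //= eV ?(negbTE nv) ?andbF //.
rewrite eqxx mulr1 big1 ?addr0 // => u nuv.
by rewrite eV ?(negbTE nv) ?andbF // (negbTE nuv) mulr0.
Qed.

Lemma conj_rotation_out g i j V A u v :
  elementary_rotation g i j V -> ~~ in_pivot i j u -> ~~ in_pivot i j v ->
  (V^T *m A *m V) u v = A u v.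
Proof.
move=> rV nu nv; rewrite (mulmx_rotation_out _ _ rV nv).
have -> : (V^T *m A) u v = (A^T *m V) v u.
  by rewrite -[A in LHS]trmxK -trmx_mul mxE.
by rewrite (mulmx_rotation_out _ _ rV nu) mxE.
Qed.

(** Rotations with disjoint pivots commute, and each leaves the pivot submatrix of the other
    unchanged, so both submatrices are diagonal in either order. *)
Lemma diagonalizing_step_comm g i j k l A B C :
  [&& i != k, i != l, j != k & j != l] ->
  diagonalizing_step g (i, j) A B -> diagonalizing_step g (k, l) B C ->
  exists2 B', diagonalizing_step g (k, l) A B' &
    diagonalizing_step g (i, j) B' C.
Proof.
move=> /and4P[nik nil njk njl] [V [/= rV eB dB]] [W [/= rW eC dC]].
have disj u : in_pivot i j u -> ~~ in_pivot k l u.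
  rewrite /in_pivot negb_or => /orP[]/eqP->; exact/andP.
have comm : V *m W = W *m V.
  (* [V - I] and [W - I] live on disjoint index sets, so both products vanish; expanding them gives
     [V W = W V]. *)
  have h1 : (V - 1%:M) *m (W - 1%:M) = 0.
    apply/matrixP => u v; rewrite !mxE big1 // => w _; rewrite !mxE.
    case: rV rW => _ _ eV _ _ [_ _ eW _ _].
    have [pw|npw] := boolP (in_pivot i j w).
      by rewrite eW ?(negbTE (disj _ pw)) // subrr mulr0.
    by rewrite eV ?(negbTE npw) ?andbF // subrr mul0r.
  have h2 : (W - 1%:M) *m (V - 1%:M) = 0.
    apply/matrixP => u v; rewrite !mxE big1 // => w _; rewrite !mxE.
    case: rV rW => _ _ eV _ _ [_ _ eW _ _].
    have [pw|npw] := boolP (in_pivot i j w).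
      by rewrite eW ?(negbTE (disj _ pw)) ?andbF // subrr mul0r.
    by rewrite eV ?(negbTE npw) // subrr mulr0.
  move: h1 h2; rewrite !mulmxBl !mulmxBr !mul1mx !mulmx1.
  move=> /eqP; rewrite subr_eq0 subr_eq => /eqP->.
  by move=> /eqP; rewrite subr_eq0 subr_eq => /eqP->; rewrite addrC addrA addrAC.
have eC' : C = V^T *m (W^T *m A *m W) *m V.
  rewrite eC eB !mulmxA -trmx_mul comm trmx_mul -mulmxA comm.
  by rewrite !mulmxA.
exists (W^T *m A *m W).
  exists W; split=> //= u v nuv pu pv.
  have npu : ~~ in_pivot i j u by apply: contraL pu; apply: disj.
  have npv : ~~ in_pivot i j v by apply: contraL pv; apply: disj.
  by rewrite -(conj_rotation_out _ rV npu npv) -eC' dC.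
exists V; split=> //= u v nuv pu pv.
by rewrite eC (conj_rotation_out _ rW (disj _ pu) (disj _ pv)) dB.
Qed.

Lemma orthogonal_norm V (x : 'rV[R]_N) : V^T *m V = 1%:M ->
  \sum_u (x *m V) 0 u ^+ 2 = \sum_u x 0 u ^+ 2.
Proof.
have sqE (y : 'rV[R]_N) : \sum_u y 0 u ^+ 2 = (y *m y^T) 0 0.
  by rewrite mxE; apply: eq_bigr => u _; rewrite mxE expr2.
move=> /mulmx1C oV; rewrite !sqE trmx_mul -mulmxA (mulmxA V) oV mul1mx //.
Qed.

Lemma rotation_pivot_norm g i j V (x : 'rV[R]_N) :
  elementary_rotation g i j V ->
  \sum_(u | in_pivot i j u) (x *m V) 0 u ^+ 2 =
  \sum_(u | in_pivot i j u) x 0 u ^+ 2.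
Proof.
move=> rV; have [_ oV _ _ _] := rV.
have := orthogonal_norm x oV.
rewrite (bigID (in_pivot i j)) [RHS](bigID (in_pivot i j)) /=.
rewrite [X in _ + X = _](eq_bigr (fun u => x 0 u ^+ 2)); first exact: addIr.
by move=> u nu; rewrite (mulmx_rotation_out _ _ rV nu).
Qed.

Lemma sum_pivot i j (F : 'I_N -> R) : i != j ->
  \sum_(u | in_pivot i j u) F u =
  \sum_(u | b u == i) F u + \sum_(u | b u == j) F u.
Proof.
move=> nij; rewrite (bigID (fun u => b u == i)) /=; congr (_ + _).
  by apply: eq_bigl => u; rewrite /in_pivot; case: eqP; rewrite ?andbF.
apply: eq_bigl => u; rewrite /in_pivot; case: eqP => [->|_] /=.
  by rewrite (negbTE nij).
by rewrite andbT.
Qed.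

(** From [(x V)_j = x_i V_ij + x_j V_jj], the square of [x_j V_jj] is at most twice the sum of the
    squares of [(x V)_j] and [x_i V_ij], and orthogonality bounds the latter by [x_i]. *)
Lemma rotation_lower_bound g i j V (x : 'rV[R]_N) :
  elementary_rotation g i j V ->
  g * (\sum_(u | b u == j) x 0 u ^+ 2) <=
  2 * (\sum_(u | b u == j) (x *m V) 0 u ^+ 2 + \sum_(u | b u == i) x 0 u ^+ 2).
Proof.
move=> [nij oV eV [_ gj] _].
pose mask k : 'rV[R]_N := \row_u (if b u == k then x 0 u else 0).
have mask_norm k : \sum_(u | b u == k) mask k 0 u ^+ 2 =
    \sum_(u | b u == k) x 0 u ^+ 2.
  by apply: eq_bigr => u /eqP bu; rewrite mxE bu eqxx.
rewrite -(mask_norm j).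
apply: le_trans (gj (mask j) _) _ => [u /negbTE nu|]; first by rewrite mxE nu.
have le_i : \sum_(u | b u == j) (mask i *m V) 0 u ^+ 2 <=
    \sum_(u | b u == i) x 0 u ^+ 2.
  rewrite -mask_norm [leRHS](_ : _ = \sum_u mask i 0 u ^+ 2); last first.
    rewrite [RHS](bigID (fun u => b u == i)) /= [X in _ = _ + X]big1 ?addr0 //.
    by move=> u /negbTE nu; rewrite mxE nu expr0n.
  rewrite -(orthogonal_norm _ oV) [leRHS](bigID (fun u => b u == j)) /=.
  by rewrite lerDl sumr_ge0 // => u _; apply: sqr_ge0.
have split_row u : b u == j ->
    (mask j *m V) 0 u = (x *m V) 0 u - (mask i *m V) 0 u.
  move=> /eqP bu; rewrite !mxE -sumrB; apply: eq_bigr => w _; rewrite !mxE.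
  have [bw|bwj] := eqVneq (b w) j.
    by rewrite bw eq_sym (negbTE nij) mul0r subr0.
  have [bw|bwi] := eqVneq (b w) i; first by rewrite mul0r subrr.
  rewrite eV; last by rewrite /in_pivot (negbTE bwj) (negbTE bwi).
  have [wu|_] := eqVneq w u; first by rewrite wu bu eqxx in bwj.
  by rewrite !mulr0 subrr.
apply: (@le_trans _ _ (2 * (\sum_(u | b u == j) (x *m V) 0 u ^+ 2 +
    \sum_(u | b u == j) (mask i *m V) 0 u ^+ 2))); last first.
  by rewrite ler_pM2l // lerD2l.
rewrite -big_split mulr_sumr; apply: ler_sum => u bu; rewrite (split_row u bu).
have sqrB_le (a c : R) : (a - c) ^+ 2 <= 2 * (a ^+ 2 + c ^+ 2).
  by have := sqr_ge0 (a + c); lra.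
exact: sqrB_le.
Qed.

Lemma conj_rotation_row g i j V A u v :
  elementary_rotation g i j V -> ~~ in_pivot i j u ->
  (V^T *m A *m V) u v = (row u A *m V) 0 v.
Proof.
move=> rV nu.
have -> : (V^T *m A *m V) u v = ((A *m V)^T *m V) v u.
  by rewrite -mulmxA -[A *m V in LHS]trmxK -trmx_mul mxE.
rewrite (mulmx_rotation_out _ _ rV nu) !mxE.
by apply: eq_bigr => w _; rewrite mxE.
Qed.

Lemma sum_row A u (P : pred 'I_N) :
  \sum_(v | P v) (row u A) 0 v ^+ 2 = \sum_(v | P v) A u v ^+ 2.
Proof. by apply: eq_bigr => v _; rewrite mxE. Qed.

Lemma blocknorm_ge0 A r s : 0 <= blocknorm A r s.
Proof. by apply: sumr_ge0 => u _; apply: sumr_ge0 => v _; apply: sqr_ge0. Qed.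

Lemma blocknormC A r s : A^T = A -> blocknorm A r s = blocknorm A s r.
Proof.
move=> sA; rewrite /blocknorm exchange_big /=.
by apply: eq_bigr => u _; apply: eq_bigr => v _; rewrite -[in LHS]sA mxE.
Qed.

Lemma blocknorm_rotation_out g i j V A r s :
  elementary_rotation g i j V -> r != i -> r != j -> s != i -> s != j ->
  blocknorm (V^T *m A *m V) r s = blocknorm A r s.
Proof.
move=> rV ri rj si sj; apply: eq_bigr => u /eqP bu; apply: eq_bigr => v /eqP bv.
by rewrite (conj_rotation_out _ rV) // /in_pivot (bu, bv) negb_or; apply/andP.
Qed.

Lemma blocknorm_rotation_row g i j V A r :
  elementary_rotation g i j V -> r != i -> r != j ->
  blocknorm (V^T *m A *m V) r i + blocknorm (V^T *m A *m V) r j =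
  blocknorm A r i + blocknorm A r j.
Proof.
move=> rV ri rj; rewrite /blocknorm -!big_split /=; apply: eq_bigr => u /eqP bu.
have [nij _ _ _ _] := rV.
have nu : ~~ in_pivot i j u by rewrite /in_pivot bu negb_or; apply/andP.
rewrite -!sum_pivot // (eq_bigr (fun v => (row u A *m V) 0 v ^+ 2)).
  rewrite (rotation_pivot_norm _ rV).
  by apply: eq_bigr => v _; rewrite mxE.
by move=> v _; rewrite (conj_rotation_row _ _ rV nu).
Qed.

Lemma blocknorm_rotation_lower_bound g i j V A r :
  elementary_rotation g i j V -> r != i -> r != j ->
  g * blocknorm A r j <=
  2 * (blocknorm (V^T *m A *m V) r j + blocknorm A r i).
Proof.
move=> rV ri rj; rewrite /blocknorm -big_split !mulr_sumr /=.
apply: ler_sum => u /eqP bu.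
have nu : ~~ in_pivot i j u by rewrite /in_pivot bu negb_or; apply/andP.
rewrite -(sum_row A u (fun v => b v == j)) -(sum_row A u (fun v => b v == i)).
apply: (le_trans (rotation_lower_bound (row u A) rV)).
rewrite ler_pM2l // lerD2r le_eqVlt; apply/orP; left.
by apply/eqP; apply: eq_bigr => v _; rewrite (conj_rotation_row _ _ rV nu).
Qed.

Definition offdiag_sum A : R := \sum_u \sum_(v | v != u) A u v ^+ 2.

Lemma offdiag_sumE A :
  offdiag_sum A = \sum_u \sum_v A u v ^+ 2 - \sum_u A u u ^+ 2.
Proof.
rewrite /offdiag_sum -sumrB; apply: eq_bigr => u _.
by rewrite [in RHS](bigD1 u) //= addrAC subrr add0r.
Qed.

(** Apply the invariance to rows, then to columns. It serves for all indices (Frobenius norm) and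
    for the pivot indices (norm of the pivot submatrix). *)
Lemma conj_norm V A (P : pred 'I_N) :
  (forall x : 'rV[R]_N,
     \sum_(u | P u) (x *m V) 0 u ^+ 2 = \sum_(u | P u) x 0 u ^+ 2) ->
  \sum_(u | P u) \sum_(v | P v) (V^T *m A *m V) u v ^+ 2 =
  \sum_(u | P u) \sum_(v | P v) A u v ^+ 2.
Proof.
move=> normV.
have rows X : \sum_(u | P u) \sum_(v | P v) (X *m V) u v ^+ 2 =
    \sum_(u | P u) \sum_(v | P v) X u v ^+ 2.
  apply: eq_bigr => u _.
  rewrite [RHS](eq_bigr (fun v => (row u X) 0 v ^+ 2)).
    by rewrite -normV; apply: eq_bigr => v _; rewrite -row_mul [in RHS]mxE.
  by move=> v _; rewrite mxE.
rewrite rows exchange_big [RHS]exchange_big /=.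
rewrite (eq_bigr (fun v => \sum_(u | P u) (A^T *m V) v u ^+ 2)).
  rewrite rows; apply: eq_bigr => v _; apply: eq_bigr => u _; by rewrite mxE.
move=> v _; apply: eq_bigr => u _.
by rewrite -[A in LHS]trmxK -trmx_mul mxE.
Qed.

(** The Frobenius norm is invariant, so the decrease equals the gain of the diagonal. That gain
    occurs in the pivot submatrix, whose whole norm ends up on its diagonal. *)
Lemma offdiag_sum_step g i j A A' :
  diagonalizing_step g (i, j) A A' ->
  offdiag_sum A' + blocknorm A i j <= offdiag_sum A.
Proof.
move=> [V [/= rV -> dA]]; have [nij oV _ _ _] := rV.
pose P := in_pivot i j; set B := V^T *m A *m V in dA *.
rewrite !offdiag_sumE (conj_norm A (P := predT)); last first.
  by move=> x; apply: orthogonal_norm.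
rewrite -addrA lerD2l addrC lerBlDr addrC.
rewrite [X in _ <= X - _](bigID P) [X in _ <= _ - X](bigID P) /=.
rewrite [X in _ <= (_ + X) - _](eq_bigr (fun u => A u u ^+ 2)); last first.
  by move=> u nu; rewrite /B (conj_rotation_out _ rV nu nu).
rewrite opprD addrACA subrr addr0.
have -> : \sum_(u | P u) B u u ^+ 2 = \sum_(u | P u) \sum_(v | P v) A u v ^+ 2.
  rewrite -(conj_norm A (fun x => rotation_pivot_norm x rV)).
  apply: eq_bigr => u pu; rewrite (bigD1 u) //= big1 ?addr0 // => v /andP[pv nvu].
  by rewrite dA ?expr0n // eq_sym.
rewrite -sumrB (sum_pivot _ nij) /blocknorm.
rewrite -[leLHS]addr0; apply: lerD.
  (* Rows of block [i] already supply the norm of [A_ij]; rows of block [j] contribute something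
     nonnegative. *)
  apply: ler_sum => u bu.
  rewrite [X in _ <= X - _](bigD1 u) /=; last by rewrite /P /in_pivot bu.
  rewrite addrAC subrr add0r [leRHS](bigID (fun v => b v == j)) /=.
  rewrite (_ : \sum_(v | b v == j) _ = \sum_(v | P v && (v != u) && (b v == j))
     A u v ^+ 2).
    by rewrite lerDl sumr_ge0 // => v _; apply: sqr_ge0.
  apply: eq_bigl => v; rewrite /P /in_pivot.
  case: (b v =P j) => bv; rewrite ?andbF // andbT orbT /=.
  apply/esym/eqP => vu; move: nij; rewrite -(eqP bu) -bv vu eqxx //.
apply: sumr_ge0 => u bu; rewrite (bigD1 u) /=; last by rewrite /P /in_pivot bu orbT.
by rewrite addrAC subrr add0r; apply: sumr_ge0 => v _; apply: sqr_ge0.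
Qed.

End Flat.

(** * Column orderings *)

(** Each new label [k] is paired with all earlier labels, in any order. Labels carry no order of
    their own, so the notion survives relabelling. *)
Inductive column_ordering (T : eqType) : seq T -> seq (T * T) -> Prop :=
| column_ordering_nil : column_ordering [::] [::]
| column_ordering_rcons js l k rs :
    column_ordering js l -> k \notin js -> perm_eq rs js ->
    column_ordering (rcons js k) (l ++ [seq (r, k) | r <- rs]).

Lemma column_ordering_uniq (T : eqType) (js : seq T) l :
  column_ordering js l -> uniq js.
Proof.
by elim=> [//|{}js {}l k rs _ ujs nk _]; rewrite rcons_uniq nk.
Qed.

Lemma column_ordering_mem (T : eqType) (js : seq T) l :
  column_ordering js l -> all (fun x => (x.1 \in js) && (x.2 \in js)) l.
Proof.
elim=> [//|{}js {}l k rs _ /allP lP _ rsjs]; rewrite all_cat.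
apply/andP; split; apply/allP => x.
  by move=> /lP/andP[h1 h2]; rewrite !mem_rcons !inE h1 h2 !orbT.
case/mapP=> r; rewrite (perm_mem rsjs) => hr -> /=.
by rewrite !mem_rcons !inE hr eqxx orbT.
Qed.

Lemma column_ordering_size (T : eqType) (js : seq T) l :
  column_ordering js l -> (size l <= size js ^ 2)%N.
Proof.
elim=> [//|{}js {}l k rs _ h _ /perm_size e].
rewrite size_cat size_map size_rcons e.
apply: leq_trans (leq_add h (leqnn _)) _.
rewrite -!mulnn; nia.
Qed.

(** * Propagation of block bounds along a column ordering *)

Section SmallSteps.
Variables (R : realType) (N : nat) (T : eqType) (b : 'I_N -> T).
Variables (g D : R).
Hypotheses (g_gt0 : 0 < g) (D_ge0 : 0 <= D).
Implicit Types (A B V : 'M[R]_N) (i j k r s : T) (E : R).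
Local Notation blocknorm := (blocknorm b).

(* Unlike [diagonalizing_step], this relation is symmetric in [A] and [A'], *)
(* which reduces reversed orderings to the direct ones. *)
Definition small_pivot_step (x : T * T) A A' := exists V,
  [/\ elementary_rotation b g x.1 x.2 V, A' = V^T *m A *m V,
      blocknorm A x.1 x.2 <= D & blocknorm A' x.1 x.2 <= D].

Definition bounded_blocks (js : seq T) E A :=
  forall r s, r \in js -> s \in js -> r != s -> blocknorm A r s <= E.

Lemma small_pivot_step_sym x A A' :
  small_pivot_step x A A' -> small_pivot_step x A' A.
Proof.
move=> [V [rV eA dA dA']]; exists V^T; split=> //.
  exact: elementary_rotationT.
case: rV => _ /mulmx1C oV _ _ _.
by rewrite trmxK eA !mulmxA oV mul1mx -mulmxA oV mulmx1.
Qed.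

Lemma small_pivot_step_tr x A A' :
  A^T = A -> small_pivot_step x A A' -> A'^T = A'.
Proof. by move=> sA [V [_ -> _ _]]; rewrite !trmx_mul trmxK sA mulmxA. Qed.

Lemma small_pivot_chain_tr l A A' :
  A^T = A -> chain small_pivot_step l A A' -> A'^T = A'.
Proof.
by elim: l A => [|x l IH] A sA /= => [<-//|[B /(small_pivot_step_tr sA)/IH]].
Qed.

(** In a row outside the pivot, the rotation preserves the sum of the two squared block norms, so
    each is at most [2 * E]; the pivot block is small by definition of the step. *)
Lemma small_pivot_step_growth js E i j A A' :
  A^T = A -> D <= E -> i \in js -> j \in js ->
  small_pivot_step (i, j) A A' ->
  bounded_blocks js E A -> bounded_blocks js (2 * E) A'.
Proof.
move=> sA DE ij jj stA bA r s.
have sA' := small_pivot_step_tr sA stA.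
case: stA => [V [/= rV eA dA dA']].
have E0 : 0 <= E by apply: le_trans DE.
have E2 : E <= 2 * E by lra.
have row t k : t \in js -> t != i -> t != j -> (k == i) || (k == j) ->
    blocknorm A' t k <= 2 * E.
  move=> tj ti tj' kij.
  have := blocknorm_rotation_row A rV ti tj'; rewrite -eA => e.
  have := bA _ _ tj ij ti; have := bA _ _ tj jj tj'.
  have := blocknorm_ge0 b A' t i; have := blocknorm_ge0 b A' t j.
  by case/orP: kij => /eqP->; lra.
have piv : blocknorm A' i j <= 2 * E.
  by apply: le_trans dA' _; apply: le_trans DE _.
move=> rj sj rs.
have [rp|] := boolP ((r == i) || (r == j)); last first.
  rewrite negb_or => /andP[ri rj'].
  have [sp|] := boolP ((s == i) || (s == j)); first exact: row.
  rewrite negb_or => /andP[si sj'].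
  by rewrite eA (blocknorm_rotation_out A rV) //; apply: le_trans E2; apply: bA.
have [sp|] := boolP ((s == i) || (s == j)); last first.
  by rewrite negb_or => /andP[si sj']; rewrite (blocknormC _ _ _ sA'); apply: row.
case/orP: rp rs => /eqP->; case/orP: sp => /eqP->; rewrite ?eqxx // => _.
by rewrite (blocknormC _ _ _ sA').
Qed.

Lemma small_pivot_chain_growth js E l A A' :
  A^T = A -> D <= E -> all (fun x => (x.1 \in js) && (x.2 \in js)) l ->
  chain small_pivot_step l A A' ->
  bounded_blocks js E A -> bounded_blocks js (2 ^+ size l * E) A'.
Proof.
elim: l A E => [|[i j] l IH] A E sA DE /=; first by move=> _ <-; rewrite mul1r.
move=> /andP[/andP[ij jj] hl] [B hB hBA'] bA.
have DE2 : D <= 2 * E by move: D_ge0; lra.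
rewrite exprSr -mulrA; apply: (IH B) => //.
  exact: small_pivot_step_tr hB.
exact: small_pivot_step_growth hB bA.
Qed.

(** If two blocks are at most [Z], [blocknorm_rotation_lower_bound] yields [4 * Z / g]; the summand
    1 makes powers of [K] nondecreasing. *)
Let K : R := 1 + 4 / g.

Lemma column_constant_ge1 : 1 <= K.
Proof. by rewrite lerDl divr_ge0 // ltW. Qed.

(* Read backwards from the elimination of [(r, k)], each step of the column *)
(* loses at most a factor [K] on the block [(r, k)]. *)
Lemma column_bound rs k E A A' :
  uniq rs -> k \notin rs -> D <= E -> bounded_blocks rs E A ->
  chain small_pivot_step [seq (r, k) | r <- rs] A A' ->
  forall r, r \in rs -> blocknorm A r k <= K ^+ size rs * E.
Proof.
move=> + + DE; have E0 : 0 <= E by apply: le_trans DE.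
have K1 := column_constant_ge1.
elim: rs A => [//|s rs IH] A /= /andP[sr urs].
rewrite inE negb_or => /andP[ks kr] bA [B [V [/= rV eB dA _]] hB] r.
rewrite inE; have [-> _|nrs /= rrs] := eqVneq r s.
  apply: (le_trans dA); apply: (le_trans DE).
  by rewrite ler_peMl // exprn_ege1.
have rk : r != k by apply: contraNneq kr => <-.
(* The remaining labels avoid the pivot pair [(s, k)], so these blocks do not change. *)
have bB : bounded_blocks rs E B.
  move=> t u tr ur tu; rewrite eB (blocknorm_rotation_out A rV).
  - by apply: bA => //; rewrite inE (tr, ur) orbT.
  - by apply: contraNneq sr => <-.
  - by apply: contraNneq kr => <-.
  - by apply: contraNneq sr => <-.
  - by apply: contraNneq kr => <-.
have hr := IH B urs kr bB hB r rrs.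
have := blocknorm_rotation_lower_bound A rV nrs rk; rewrite -eB => low.
have ars : blocknorm A r s <= E.
  by apply: bA => //; rewrite inE ?eqxx ?rrs ?orbT.
rewrite exprS -mulrA; set Z := K ^+ _ * E in hr *.
have EZ : E <= Z by rewrite /Z ler_peMl // exprn_ege1.
have -> : K * Z = Z + (4 * Z) / g by rewrite /K; ring.
have h4 : blocknorm A r k <= 4 * Z / g.
  by rewrite ler_pdivlMr // mulrC; lra.
by apply: (le_trans h4); rewrite lerDr; apply: le_trans EZ.
Qed.

(** Induction on columns. Before column [k], the earlier blocks are bounded by induction and those
    of column [k] by [column_bound]; running the column then costs a factor 2 per step. A column of
    length [c] thus costs [(2 * K) ^+ c]. *)
Lemma column_ordering_bound js l A A' :
  column_ordering js l -> A^T = A -> chain small_pivot_step l A A' ->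
  bounded_blocks js ((2 * K) ^+ (size js ^ 2) * D) A'.
Proof.
move=> ol sA; have K1 := column_constant_ge1.
have K2 : 1 <= 2 * K by move: K1; lra.
elim: ol A' => [|{}js {}l k rs ol IH nk rsjs] A'; first by move=> _ r.
rewrite chain_cat => -[B hAB hBA'].
have sB := small_pivot_chain_tr sA hAB.
set E := (2 * K) ^+ (size js ^ 2) * D in IH.
have DE : D <= E by rewrite /E ler_peMl // exprn_ege1.
have E0 : 0 <= E by apply: le_trans DE.
have bB := IH B hAB.
have KE : E <= K ^+ size rs * E by rewrite ler_peMl // exprn_ege1.
have bB' : bounded_blocks (rcons js k) (K ^+ size rs * E) B.
  have col r : r \in js -> blocknorm B r k <= K ^+ size rs * E.
    rewrite -(perm_mem rsjs); apply: (column_bound _ _ DE _ hBA').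
    - by rewrite (perm_uniq rsjs) (column_ordering_uniq ol).
    - by rewrite (perm_mem rsjs).
    - by move=> t u; rewrite !(perm_mem rsjs); apply: bB.
  move=> r s; rewrite !mem_rcons !inE.
  have [->|_] /= := eqVneq r k; have [->|_] /= := eqVneq s k; rewrite ?eqxx //.
  - by move=> _ sj _; rewrite (blocknormC _ _ _ sB); apply: col.
  - by move=> rj _ _; apply: col.
  - by move=> rj sj rs'; apply: le_trans KE; apply: bB.
have := small_pivot_chain_growth sB _ _ hBA' bB'.
rewrite size_map (perm_size rsjs).
have -> : 2 ^+ size js * (K ^+ size js * E) =
    (2 * K) ^+ (size js + size js ^ 2) * D by rewrite exprD exprMn /E; ring.
move=> h r s rj sj rs'; apply: le_trans (h _ _ r s rj sj rs') _.
- by apply: (le_trans DE); rewrite -(perm_size rsjs).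
- apply/allP => x /mapP[t tr ->] /=; rewrite !mem_rcons !inE eqxx /= andbT.
  by rewrite -(perm_mem rsjs) tr orbT.
apply: ler_wpM2r => //; apply: ler_weXn2l => //.
by rewrite size_rcons -!mulnn mulSn mulnS addSn leqW // leq_addl.
Qed.

(** Read backwards, the sweep is a direct one ending at [A], which bounds the blocks of [A]; going
    forward again costs a factor 2 per step. *)
Lemma column_ordering_bound_rev js l A A' :
  column_ordering js l -> A^T = A -> chain small_pivot_step (rev l) A A' ->
  bounded_blocks js (2 ^+ (size js ^ 2) * ((2 * K) ^+ (size js ^ 2) * D)) A'.
Proof.
move=> ol sA hA; have K1 := column_constant_ge1.
have K2 : 1 <= 2 * K by move: K1; lra.
have sA' := small_pivot_chain_tr sA hA.
have := chain_rev small_pivot_step_sym hA; rewrite revK => hA'.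
have bA := column_ordering_bound ol sA' hA'.
have DE : D <= (2 * K) ^+ (size js ^ 2) * D by rewrite ler_peMl // exprn_ege1.
have := small_pivot_chain_growth sA DE _ hA bA.
move=> h r s rj sj rs; apply: le_trans (h _ r s rj sj rs) _.
  by rewrite all_rev (column_ordering_mem ol).
rewrite size_rev; apply: ler_wpM2r; first exact: le_trans DE.
by apply: ler_weXn2l; [lra|exact: column_ordering_size].
Qed.

End SmallSteps.

(** * Singular values and the Rayleigh quotient *)

Section Rayleigh.
Variable R : realType.

(** Over the complex numbers [G] is Hermitian, hence unitarily diagonalizable with real spectrum; in
    the coordinates [y] both forms are sums of squared moduli, weighted by eigenvalues in one of
    them. *)
Lemma symmetric_rayleigh n (G : 'M[R]_n) (c : R) :
  G^T = G -> (forall a, eigenvalue G a -> c <= a) ->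
  forall x : 'rV_n, c * (x *m x^T) 0 0 <= (x *m G *m x^T) 0 0.
Proof.
move=> sG hc x.
pose f := real_complex R.
have fconj r : Num.conj (f r) = f r.
  by apply: conj_Creal; rewrite complex_real.
pose Gc : 'M[R[i]]_n := map_mx f G.
have herm : Gc \is hermsymmx.
  apply/is_hermitianmxP/matrixP => i j; rewrite expr0 scale1r !mxE fconj.
  by rewrite -[in LHS]sG mxE.
have /hermitian_normalmx /orthomx_spectralP eG := herm.
have uP := spectral_unitarymx Gc.
have invP := invmx_unitary uP.
have unitP := spectral_unit Gc.
have realD := hermitian_spectral_diag_real herm.
set P := spectralmx Gc in eG uP invP unitP.
set d := spectral_diag Gc in eG realD.
have hd k : f c <= d 0 k.
  have /complex_realP [r er] : d 0 k \is Num.real by apply: (mxOverP realD).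
  have : eigenvalue Gc (f r).
    apply/eigenvalueP; exists (row k P).
      rewrite -row_mul {1}eG !mulmxA mulmxV // mul1mx.
      by apply/rowP => j; rewrite mul_diag_mx !mxE /f -er.
    apply/eqP => rk0; have := congr1 (row k) (mulmxV unitP).
    rewrite row_mul rk0 mul0mx => /rowP/(_ k); rewrite !mxE eqxx => /eqP.
    by rewrite eq_sym oner_eq0.
  by rewrite eigenvalue_map er lecR; apply: hc.
pose y := map_mx f x *m (P ^t Num.conj)%sesqui.
have normE : f ((x *m x^T) 0 0) = \sum_k `|y 0 k| ^+ 2.
  transitivity ((map_mx f (x *m x^T)) 0 0); first by rewrite [RHS]mxE.
  rewrite map_mxM /= -map_trmx.
  have -> : map_mx f x *m (map_mx f x)^T = y *m (y ^t Num.conj)%sesqui.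
    rewrite /y trmx_mul map_mxM /= trmxCK -mulmxA (mulmxA _ P) -invP.
    rewrite mulVmx // mul1mx; congr (_ *m _).
    by apply/matrixP => i j; rewrite !mxE fconj.
  rewrite mxE; apply: eq_bigr => k _; by rewrite !mxE normCK.
have formE : f ((x *m G *m x^T) 0 0) = \sum_k d 0 k * `|y 0 k| ^+ 2.
  transitivity ((map_mx f (x *m G *m x^T)) 0 0); first by rewrite [RHS]mxE.
  rewrite !map_mxM /= -/Gc eG.
  have -> : map_mx f x *m (invmx P *m diag_mx d *m P) *m map_mx f x^T =
      y *m diag_mx d *m (y ^t Num.conj)%sesqui.
    rewrite /y trmx_mul map_mxM /= trmxCK -invP !mulmxA.
    congr (_ *m _); apply/matrixP => i j; by rewrite !mxE fconj.
  rewrite mxE; apply: eq_bigr => k _.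
  by rewrite mul_mx_diag !mxE normCK mulrAC mulrC mulrA.
rewrite -lecR (_ : (c * _)%:C%C = f c * f ((x *m x^T) 0 0)); last exact: rmorphM.
rewrite -/f formE normE mulr_sumr; apply: ler_sum => k _.
by apply: ler_wpM2r; rewrite ?exprn_ge0.
Qed.

Lemma row_normE n (x : 'rV[R]_n) : (x *m x^T) 0 0 = \sum_k x 0 k ^+ 2.
Proof. by rewrite mxE; apply: eq_bigr => k _; rewrite mxE expr2. Qed.

(** An eigenvalue [a] of [B^T B] is nonnegative and its root is a singular value, hence at least the
    infimum [sigma_min B]; the Rayleigh bound concludes. *)
Lemma singular_value_bound n (B : 'M[R]_n) (s0 : R) :
  0 < s0 -> s0 <= sigma_min B -> forall x : 'rV_n,
  s0 ^+ 2 * \sum_k x 0 k ^+ 2 <= \sum_k (x *m B^T) 0 k ^+ 2.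
Proof.
move=> s0_gt0 hs x.
have gram (y : 'rV_n) : (y *m (B^T *m B) *m y^T) 0 0 = \sum_k (y *m B^T) 0 k ^+ 2.
  by rewrite -row_normE trmx_mul trmxK !mulmxA.
rewrite -row_normE -gram; apply: symmetric_rayleigh => [|a].
  by rewrite trmx_mul trmxK.
move=> ea; have a_ge0 : 0 <= a.
  have /eigenvalueP[v hv v0] := ea.
  have nv : 0 < (v *m v^T) 0 0.
    rewrite row_normE lt_def sumr_ge0 ?andbT; last by move=> k _; apply: sqr_ge0.
    apply: contra v0 => /eqP h; apply/eqP/rowP => k; rewrite mxE; apply/eqP.
    rewrite -sqrf_eq0; apply/eqP.
    by have /psumr_eq0P := h; apply=> // ? _; apply: sqr_ge0.
  rewrite -(pmulr_lge0 _ nv).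
  have <- : (v *m (B^T *m B) *m v^T) 0 0 = a * (v *m v^T) 0 0.
    by rewrite hv -scalemxAl mxE.
  by rewrite gram sumr_ge0 // => k _; apply: sqr_ge0.
have lb : s0 <= Num.sqrt a.
  apply: (le_trans hs); apply: ge_inf; first by exists 0 => s [].
  by split; [apply: sqrtr_ge0|rewrite sqr_sqrtr].
by rewrite -(sqr_sqrtr a_ge0) ler_sqr ?nnegrE ?sqrtr_ge0 // ltW.
Qed.

(* With [y = x (B^T)^-1], expand [0 <= |x B - s0^2 y|^2]. *)
Lemma singular_value_bound_tr n (B : 'M[R]_n) (s0 : R) :
  0 < s0 -> s0 <= sigma_min B -> forall x : 'rV_n,
  s0 ^+ 2 * \sum_k x 0 k ^+ 2 <= \sum_k (x *m B) 0 k ^+ 2.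
Proof.
move=> s0_gt0 hs x; have bnd := singular_value_bound s0_gt0 hs.
have s2 : 0 < s0 ^+ 2 by rewrite exprn_gt0.
(* The lower bound leaves no nonzero vector in the left kernel of [B^T]. *)
have unitBT : B^T \in unitmx.
  rewrite -row_free_unit -kermx_eq0; apply/rowV0P => v /sub_kermxP vB.
  have := bnd v; rewrite vB => h; apply/rowP => k; rewrite mxE; apply/eqP.
  rewrite -sqrf_eq0; apply/eqP.
  have h0 : \sum_k v 0 k ^+ 2 = 0.
    apply/eqP; rewrite eq_le; apply/andP; split; last first.
      by apply: sumr_ge0 => j _; apply: sqr_ge0.
    rewrite -(pmulr_rle0 _ s2); apply: (le_trans h).
    by rewrite big1 // => j _; rewrite mxE expr0n.
  by have /psumr_eq0P := h0; apply=> // ? _; apply: sqr_ge0.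
pose y := x *m invmx B^T.
have yB : y *m B^T = x by rewrite /y mulmxKV.
have := bnd y; rewrite yB => hy.
have cross : \sum_k (x *m B) 0 k * y 0 k = \sum_k x 0 k ^+ 2.
  rewrite -row_normE -{3}yB trmx_mul trmxK mulmxA [RHS]mxE.
  by apply: eq_bigr => k _; rewrite [y^T _ _]mxE.
have : 0 <= \sum_k ((x *m B) 0 k - s0 ^+ 2 * y 0 k) ^+ 2.
  by apply: sumr_ge0 => k _; apply: sqr_ge0.
have -> : \sum_k ((x *m B) 0 k - s0 ^+ 2 * y 0 k) ^+ 2 =
    \sum_k (x *m B) 0 k ^+ 2 - 2 * s0 ^+ 2 * (\sum_k x 0 k ^+ 2) +
    s0 ^+ 2 * (s0 ^+ 2 * \sum_k y 0 k ^+ 2).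
  rewrite -cross !mulr_sumr -sumrB -big_split /=.
  by apply: eq_bigr => k _; ring.
have := ler_wpM2l (ltW s2) hy; lra.
Qed.

End Rayleigh.

(** * From the block Jacobi method to block rotations *)

Section Blocks.
Variables (R : realType) (m : nat) (p : 'I_m -> nat).
Local Notation N := (\sum_i p i)%N.
Local Notation blk := (@tagnat.sig1 m p).
Implicit Types (A V : 'M[R]_N) (i j k : 'I_m).

Lemma Rank_surj (u : 'I_N) k : blk u = k ->
  exists w : 'I_(p k), u = tagnat.Rank k w.
Proof. by case: _ /; exists (tagnat.sig2 u); rewrite tagnat.sig2K. Qed.

Lemma sum_block (F : 'I_N -> R) k :
  \sum_(u | blk u == k) F u = \sum_(w < p k) F (tagnat.Rank k w).
Proof.
rewrite (reindex (@tagnat.rank m p)) /=; last exact/onW_bij/tagnat.rank_bij.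
rewrite (eq_bigl (fun t : {i & 'I_(p i)} => (tag t == k) && true)); last first.
  by move=> t; rewrite tagnat.rankE tagnat.Rank1K andbT.
rewrite (eq_bigr (fun t => F (tagnat.Rank (tag t) (tagged t)))); last first.
  by move=> t _; rewrite tagnat.rankE.
by rewrite -(sig_big_dep (fun i => i == k) (fun i _ => true)
  (fun i w => F (tagnat.Rank i w))) /= big_pred1_eq.
Qed.

Lemma bounded_below_block g k V :
  (forall x : 'rV[R]_(p k), g * \sum_w x 0 w ^+ 2 <=
     \sum_w (x *m submxblock V k k) 0 w ^+ 2) ->
  bounded_below blk g k V.
Proof.
move=> h x x0; rewrite !sum_block.
have := h (\row_w x 0 (tagnat.Rank k w)).
rewrite (eq_bigr (fun w => x 0 (tagnat.Rank k w) ^+ 2)); last first.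
  by move=> w _; rewrite mxE.
move=> /le_trans; apply; rewrite le_eqVlt; apply/orP; left; apply/eqP.
apply: eq_bigr => w _; congr (_ ^+ 2); rewrite !mxE.
rewrite [RHS](bigID (fun u => blk u == k)) /= [X in _ = _ + X]big1 ?addr0.
  by rewrite sum_block; apply: eq_bigr => v _; rewrite !mxE.
by move=> u nu; rewrite x0 // mul0r.
Qed.

Lemma elementary_block_ul i j (U : 'M[R]_(p i + p j)) :
  submxblock (elementary_block U) i i = ulsubmx U.
Proof. by rewrite mxblockK !eqxx /= conform_mx_id. Qed.

Lemma elementary_block_dr i j (U : 'M[R]_(p i + p j)) : i != j ->
  submxblock (elementary_block U) j j = drsubmx U.
Proof.
by move=> nij; rewrite mxblockK eq_sym (negbTE nij) eqxx /= conform_mx_id.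
Qed.

Lemma elementary_block_out i j (U : 'M[R]_(p i + p j)) (u v : 'I_N) :
  ~~ (in_pivot blk i j u && in_pivot blk i j v) ->
  elementary_block U u v = (u == v)%:R.
Proof.
move=> nuv.
have -> : elementary_block U u v =
    submxblock (elementary_block U) (blk u) (blk v) (tagnat.sig2 u) (tagnat.sig2 v).
  by rewrite [RHS]mxE !tagnat.sig2K.
rewrite mxblockK; move: nuv; rewrite /in_pivot.
by case: (blk u == i); case: (blk v == i); case: (blk u == j);
  case: (blk v == j) => //= _; rewrite !mxE !tagnat.sig2K.
Qed.

Lemma UBCE_elementary_rotation rho i j V (s0 : R) :
  0 < s0 -> s0 <= rho * gamma R (p i) (p j) -> UBCE rho i j V ->
  elementary_rotation blk (s0 ^+ 2) i j V.
Proof.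
move=> s0_gt0 hs [ltij [U [eV oV sing hU]]].
have nij : i != j by apply: contraTneq ltij => ->; rewrite ltnn.
have hi := le_trans hs hU; have hj := hi; rewrite sing in hj.
have trb k : submxblock V^T k k = (submxblock V k k)^T.
  by apply/matrixP => u v; rewrite !mxE.
split=> //.
- by move=> u v nuv; rewrite eV elementary_block_out.
- split; apply: bounded_below_block => x; rewrite eV.
    by rewrite elementary_block_ul; apply: singular_value_bound_tr.
  by rewrite elementary_block_dr //; apply: singular_value_bound_tr.
- split; apply: bounded_below_block => x; rewrite trb eV.
    by rewrite elementary_block_ul; apply: singular_value_bound.
  by rewrite elementary_block_dr //; apply: singular_value_bound.
Qed.

Lemma pivot_submx_diag A i j (u v : 'I_N) : i != j ->
  is_diag_mx (pivot_submx A i j) -> u != v ->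
  in_pivot blk i j u -> in_pivot blk i j v -> A u v = 0.
Proof.
move=> nij /is_diag_mxP dA + pu pv.
have nji : j != i by rewrite eq_sym.
case/orP: pu => /eqP/Rank_surj[a ->]; case/orP: pv => /eqP/Rank_surj[c ->];
  rewrite -val_eqE /= tagnat.eq_Rank ?eqxx ?(negbTE nij) ?(negbTE nji) /= => nac.
- have := dA (lshift _ a) (lshift _ c) nac.
  by rewrite block_mxEul mxE.
- have := dA (lshift _ a) (rshift _ c).
  by rewrite block_mxEur mxE; apply; rewrite /= neq_ltn ltn_addr.
- have := dA (rshift _ a) (lshift _ c).
  by rewrite block_mxEdl mxE; apply; rewrite /= neq_ltn ltn_addr ?orbT.
- have := dA (rshift _ a) (rshift _ c).
  by rewrite block_mxEdr mxE; apply; rewrite /= eqn_add2l.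
Qed.

Lemma jacobi_step_diagonalizing rho i j A A' (s0 : R) :
  0 < s0 -> s0 <= rho * gamma R (p i) (p j) -> jacobi_step rho i j A A' ->
  diagonalizing_step blk (s0 ^+ 2) (i, j) A A'.
Proof.
move=> s0_gt0 hs [V [uV eA dA]].
have rV := UBCE_elementary_rotation s0_gt0 hs uV.
have [nij _ _ _ _] := rV.
exists V; split=> //= u v; exact: (pivot_submx_diag nij dA).
Qed.

Lemma jacobi_sweep_chain rho (O : seq ('I_m * 'I_m)) A A' (s0 : R) :
  0 < s0 -> (forall i j, s0 <= rho * gamma R (p i) (p j)) ->
  jacobi_sweep rho O A A' ->
  chain (diagonalizing_step blk (s0 ^+ 2)) O A A'.
Proof.
move=> s0_gt0 hs [X [<- hX <-]]; apply: chain_nth => k hk.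
have [i [j [hO st]]] := hX k hk.
exists (i, j); first by rewrite -hO /strategy modn_small.
exact: jacobi_step_diagonalizing st.
Qed.

End Blocks.

Lemma offdiag_sum_offnorm (R : realType) n (A : 'M[R]_n) :
  A^T = A -> offdiag_sum A = 2 * offnorm A ^+ 2.
Proof.
move=> sA; rewrite /offnorm sqr_sqrtr; last first.
  by apply: sumr_ge0 => s _; apply: sumr_ge0 => t _; apply: exprn_ge0.
have -> : offdiag_sum A = \sum_(s < n) \sum_(t < n | (s < t)%N) A s t ^+ 2 +
    \sum_(s < n) \sum_(t < n | (t < s)%N) A s t ^+ 2.
  rewrite /offdiag_sum -big_split; apply: eq_bigr => s _ /=.
  rewrite (bigID (fun t : 'I_n => (s < t)%N)) /=; congr (_ + _).
    by apply: eq_bigl => t; rewrite -val_eqE /=; case: ltngtP.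
  by apply: eq_bigl => t; rewrite -val_eqE /=; case: ltngtP.
rewrite [X in _ + X](exchange_big_dep predT) //= mulr_natl mulr2n.
congr (_ + _); apply: eq_bigr => s _; apply: eq_bigr => t _.
  by rewrite real_normK // num_real.
by rewrite real_normK ?num_real // -[in RHS]sA mxE.
Qed.

(** * Equivalence of orderings and reduction to column orderings *)

Section Orderings.
Variable m : nat.
Implicit Types (O : seq ('I_m * 'I_m)) (q : 'S_m).

Lemma chain_equiv_seq (R : realType) N (b : 'I_N -> 'I_m) (g : R) O O' A A' :
  equiv_seq O O' -> chain (diagonalizing_step b g) O A A' ->
  chain (diagonalizing_step b g) O' A A'.
Proof.
move=> eO; elim: eO A A' => [{}O {}O' + A A'|//|{}O O1 O2 _ h1 _ h2 A A' /h1/h2 //].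
move=> [s1 [[i j] [[k l] [s2 [-> -> disj]]]]].
rewrite !chain_cat => -[B hAB [C hBC [D hCD hDA']]]; exists B => //.
have ne x y : x \in [set i; j] -> y \in [set k; l] -> x != y.
  move=> hx hy; apply: contraTneq isT => exy.
  have : x \in [set i; j] :&: [set k; l] by rewrite inE hx exy hy.
  by rewrite disj inE.
have [|C' hBC' hCD'] := diagonalizing_step_comm _ hBC hCD.
  by apply/and4P; split; apply: ne; rewrite !inE eqxx ?orbT.
by exists C' => //; exists D.
Qed.

Lemma equiv_seq_relabel q O O' :
  equiv_seq O O' -> equiv_seq (relabel q O) (relabel q O').
Proof.
elim=> [{}O {}O' |{}O|{}O O1 O2 _ h1 _ h2].
- move=> [s1 [x [y [s2 [-> -> disj]]]]]; apply: Relation_Operators.rt_step.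
  rewrite /relabel !map_cat /=.
  do 4 eexists; split; [reflexivity|reflexivity|].
  have im (z : 'I_m * 'I_m) :
      (let z' := if (q z.1 < q z.2)%N then (q z.1, q z.2) else (q z.2, q z.1) in
       [set z'.1; z'.2]) = q @: [set z.1; z.2].
    by rewrite imsetU !imset_set1; case: ifP => //= _; rewrite finset.setUC.
  have := im x; have := im y => /= -> ->.
  rewrite -imsetI; last by move=> ? ? _ _; apply: perm_inj.
  by rewrite disj imset0.
- exact: Relation_Operators.rt_refl.
- exact: Relation_Operators.rt_trans h1 h2.
Qed.

(** Relabelling respects the equivalence, so both alternatives in [Bspg] take one form. *)
Lemma Bspg_relabel O : Bspg O ->
  exists q O'', Bsp O'' /\ equiv_seq O (relabel q O'').
Proof.
move=> [_ [O' [O'' [_ hO'' [[[q ->] eO]|[eO [q eO']]]]]]].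
  by exists q, O''; split=> //; apply: equiv_seq_relabel.
by exists q, O''; split=> //; rewrite -eO'.
Qed.

(** The labels before [k] in [es] are those below [k], which [tau k] permutes. The order is abstract
    so that increasing order gives columns and decreasing order gives rows. *)
Lemma column_ordering_sorted (lt : rel 'I_m) (es : seq 'I_m)
    (tau : 'I_m -> 'S_m) :
  transitive lt -> irreflexive lt -> sorted lt es -> (forall x, x \in es) ->
  (forall j, perm_on [set i | lt i j] (tau j)) ->
  column_ordering es
    (flatten [seq [seq (tau j i, j) | i <- enum 'I_m & lt i j] | j <- es]).
Proof.
move=> tr irr; rewrite (sorted_pairwise tr) => pw full tauP.
suff prefix js rest : es = js ++ rest -> column_ordering js
    (flatten [seq [seq (tau j i, j) | i <- enum 'I_m & lt i j] | j <- js]).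
  by apply: (prefix es [::]); rewrite cats0.
elim/last_ind: js rest => [|js k IH] rest; first by move=> _; constructor.
rewrite cat_rcons => ees; have := IH _ ees.
move: pw full; rewrite ees pairwise_cat => /and3P[/allrelP lt_js pw /= ].
move=> /andP[/allP lt_rest _] full.
rewrite map_rcons flatten_rcons.
have -> : [seq (tau k i, k) | i <- enum 'I_m & lt i k] =
    [seq (r, k) | r <- [seq tau k i | i <- enum 'I_m & lt i k]].
  by rewrite -map_comp.
have mem_js x : (x \in js) = lt x k.
  apply/idP/idP => [xjs|xk]; first by apply: lt_js; rewrite ?mem_head.
  have := full x; rewrite mem_cat inE => /or3P[//|/eqP exk|/lt_rest kx].
    by rewrite exk irr in xk.
  by have := tr _ _ _ xk kx; rewrite irr.
have njs : k \notin js by rewrite mem_js irr.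
move=> ol; apply: column_ordering_rcons => //; apply: uniq_perm.
- rewrite (map_inj_uniq (@perm_inj _ (tau k))); exact/filter_uniq/enum_uniq.
- exact: column_ordering_uniq ol.
- move=> x; rewrite mem_js -[x in LHS](permKV (tau k)) mem_map; last exact: perm_inj.
  rewrite mem_filter mem_enum andbT.
  by have := perm_closed ((tau k)^-1%g x) (tauP k); rewrite permKV !inE => <-.
Qed.

Definition swap_pair (x : 'I_m * 'I_m) := (x.2, x.1).

Lemma enum_ord_sorted : sorted (fun i j : 'I_m => (i < j)%N) (enum 'I_m).
Proof.
by have := iota_ltn_sorted 0 m; rewrite -val_enum_ord sorted_map.
Qed.

Lemma Bc_column_ordering O : Bc O -> column_ordering (enum 'I_m) O.
Proof.
move=> [tau [tauP ->]].
apply: (@column_ordering_sorted (fun i j => (i < j)%N)) => //.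
- by move=> y x z; apply: ltn_trans.
- exact: enum_ord_sorted.
- by move=> x; rewrite mem_enum.
Qed.

Lemma Br_column_ordering O : Br O ->
  exists2 l, column_ordering (rev (enum 'I_m)) l & O = map swap_pair l.
Proof.
move=> [tau [tauP ->]].
exists (flatten [seq [seq (tau j i, j) | i : 'I_m <- enum 'I_m & (j < i)%N]
  | j : 'I_m <- rev (enum 'I_m)]).
  apply: (@column_ordering_sorted (fun i j => (j < i)%N)) => //.
  - by move=> y x z xy yz; apply: ltn_trans yz xy.
  - by move=> x; apply: ltnn.
  - by rewrite rev_sorted; apply: enum_ord_sorted.
  - by move=> x; rewrite mem_rev mem_enum.
rewrite map_flatten -map_comp; congr flatten; apply: eq_map => j /=.
by rewrite -map_comp.
Qed.

(** The map [h] records the orientation of pairs, which a diagonalizing step ignores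
    ([diagonalizing_stepC]). *)
Lemma Bsp_column_ordering O : Bsp O ->
  exists js l (h : 'I_m * 'I_m -> 'I_m * 'I_m),
  [/\ column_ordering js l, size js = m, forall x, x \in js,
      forall x, h x = x \/ h x = swap_pair x &
      O = map h l \/ O = map h (rev l)].
Proof.
have rvK P : rev O = P -> O = rev P by move=> <-; rewrite revK.
have [s1 s2] : size (enum 'I_m) = m /\ size (rev (enum 'I_m)) = m.
  by rewrite size_rev size_enum_ord.
have m1 x : x \in enum 'I_m by rewrite mem_enum.
have m2 x : x \in rev (enum 'I_m) by rewrite mem_rev.
case=> -[].
- move=> /Bc_column_ordering ol; exists (enum 'I_m), O, id.
  by split=> // [x|]; left; rewrite ?map_id.
- move=> /Br_column_ordering[l ol ->].
  by exists (rev (enum 'I_m)), l, swap_pair; split=> // [x|]; [right|left].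
- move=> /Bc_column_ordering ol; exists (enum 'I_m), (rev O), id.
  by split=> // [x|]; [left|right; rewrite map_id revK].
- move=> /Br_column_ordering[l ol /rvK ->].
  exists (rev (enum 'I_m)), l, swap_pair.
  by split=> // [x|]; right; rewrite ?map_rev.
Qed.

Lemma column_ordering_map (f : 'I_m -> 'I_m) js (l : seq ('I_m * 'I_m)) :
  injective f -> column_ordering js l ->
  column_ordering (map f js) [seq (f x.1, f x.2) | x <- l].
Proof.
move=> inj_f; elim=> [|{}js {}l k rs _ IH nk rsjs]; first exact: column_ordering_nil.
rewrite map_rcons map_cat -map_comp.
have -> : [seq ((fun x : 'I_m * 'I_m => (f x.1, f x.2)) \o pair^~ k) i | i <- rs]
    = [seq (r, f k) | r <- map f rs] by rewrite -map_comp.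
by apply: column_ordering_rcons; rewrite ?mem_map ?perm_map.
Qed.

End Orderings.

(** * Contraction over one sweep *)

Section Sweep.
Variables (R : realType) (N : nat) (T : eqType) (b : 'I_N -> T) (g : R).
Hypothesis g_gt0 : 0 < g.
Implicit Types (A : 'M[R]_N) (l : seq (T * T)) (js : seq T).

Lemma offdiag_sum_chain l A A' :
  chain (diagonalizing_step b g) l A A' -> offdiag_sum A' <= offdiag_sum A.
Proof.
elim: l A => [|[i j] l IH] A /= => [-> //|[B /offdiag_sum_step hB /IH h]].
by apply: (le_trans h); have := blocknorm_ge0 b A i j; lra.
Qed.

Lemma small_pivot_chain (D : R) l A A' :
  chain (diagonalizing_step b g) l A A' ->
  offdiag_sum A - offdiag_sum A' <= D -> 0 <= D ->
  chain (small_pivot_step b g D) l A A'.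
Proof.
move=> + + D0; elim: l A => [//|[i j] l IH] A [B hB hBA'] hD /=.
have drop := offdiag_sum_step hB; have le_B := offdiag_sum_chain hBA'.
have bn0 := blocknorm_ge0 b A i j.
exists B; last by apply: IH => //; lra.
case: hB => V [/= rV eB dB]; exists V; split=> //=; first by lra.
rewrite /blocknorm big1 // => u bu; rewrite big1 // => v bv.
have [nij _ _ _ _] := rV.
rewrite dB ?expr0n //= /in_pivot ?bu ?bv ?orbT //.
by apply: contraNneq nij => uv; rewrite -(eqP bu) uv (eqP bv).
Qed.

(** Once [k] occurs in a pivot its diagonal block is diagonal; later steps leave it alone or
    diagonalize it again. *)
Lemma chain_diag_block k l A A' :
  chain (diagonalizing_step b g) l A A' ->
  has (fun x => (x.1 == k) || (x.2 == k)) l ->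
  forall u v, u != v -> b u = k -> b v = k -> A' u v = 0.
Proof.
move=> hc hk u v nuv bu bv.
suff: has (fun x => (x.1 == k) || (x.2 == k)) l \/ A u v = 0 -> A' u v = 0.
  by apply; left.
elim: l A hc {hk} => [|[i j] l IH] A /=; first by move=> -> [].
move=> [B [V [/= rV eB dB]] hB] hk; apply: (IH B hB).
have [kij|] := boolP ((i == k) || (j == k)).
  by right; rewrite dB // /in_pivot (bu, bv) ![k == _]eq_sym.
move=> nk; move: hk; rewrite (negbTE nk) /= => -[->|Auv]; first by left.
right; rewrite eB (conj_rotation_out _ rV) // /in_pivot (bu, bv);
  by rewrite ![k == _]eq_sym.
Qed.

(** Off-diagonal entries inside a diagonal block vanish, and any other entry is at most the bound on
    its block; there are at most [N ^ 2] of them. *)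
Lemma offdiag_sum_sweep js l O A A' :
  column_ordering js l -> (forall u, b u \in js) -> A^T = A ->
  chain (diagonalizing_step b g) O A A' ->
  (forall k, has (fun x => (x.1 == k) || (x.2 == k)) O) ->
  chain (diagonalizing_step b g) l A A' \/
  chain (diagonalizing_step b g) (rev l) A A' ->
  offdiag_sum A' <= (N%:R ^+ 2 * (2 ^+ (size js ^ 2) *
    (2 * (1 + 4 / g)) ^+ (size js ^ 2))) * (offdiag_sum A - offdiag_sum A').
Proof.
move=> ol full sA hO cover hl.
set D := offdiag_sum A - offdiag_sum A'.
have D0 : 0 <= D by rewrite subr_ge0 (offdiag_sum_chain hO).
set c := (2 * (1 + 4 / g)) ^+ (size js ^ 2).
have c0 : 0 <= c.
  by rewrite exprn_ge0 // mulr_ge0 // addr_ge0 // divr_ge0 // ltW.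
have two1 : 1 <= 2 ^+ (size js ^ 2) :> R by rewrite exprn_ege1 // ler1n.
have bnd : bounded_blocks b js (2 ^+ (size js ^ 2) * (c * D)) A'.
  case: hl => hl; have hs := small_pivot_chain hl (lexx _) D0; last first.
    exact: column_ordering_bound_rev hs.
  move=> r s rj sj rs.
  apply: (le_trans (column_ordering_bound g_gt0 D0 ol sA hs rj sj rs)).
  by rewrite ler_peMl // mulr_ge0.
set E := _ * (c * D) in bnd.
have E0 : 0 <= E by rewrite mulr_ge0 ?mulr_ge0 // exprn_ge0.
have entry u v : u != v -> A' u v ^+ 2 <= E.
  move=> nuv; have [buv|nb] := eqVneq (b u) (b v).
    by rewrite (chain_diag_block hO (cover (b v)) nuv buv) ?expr0n.
  apply: le_trans (bnd _ _ (full u) (full v) nb).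
  rewrite /blocknorm (bigD1 u) //= (bigD1 v) //= -addrA lerDl addr_ge0 //.
    by apply: sumr_ge0 => w _; apply: sqr_ge0.
  by apply: sumr_ge0 => w _; apply: sumr_ge0 => z _; apply: sqr_ge0.
have -> : N%:R ^+ 2 * (2 ^+ (size js ^ 2) * c) * D = \sum_(u < N) \sum_(v < N) E.
  rewrite !sumr_const !card_ord -mulr_natl -mulr_natr /E; ring.
apply: ler_sum => u _; rewrite big_mkcond /=; apply: ler_sum => v _.
by case: ifP => [nvu|_] //; apply: entry; rewrite eq_sym.
Qed.

End Sweep.

(** [gamma] decreases in both arguments, so [gamma R n n] is a lower bound uniform over the
    partitions of [n]. *)
Lemma gamma_min (R : realType) n ni nj : (0 < ni <= n)%N -> (0 < nj <= n)%N ->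
  0 < gamma R n n <= gamma R ni nj.
Proof.
move=> /andP[ni0 nin] /andP[nj0 njn]; rewrite /gamma.
set x := (_ + 6 * nj%:R - 1) * _; set y := (_ + 6 * n%:R - 1) * _.
have x0 : 0 < x.
  have h4 : 1 <= 4 ^+ ni :> R by rewrite exprn_ege1 // ler1n.
  have hj : 1 <= nj%:R :> R by rewrite ler1n.
  by rewrite /x mulr_gt0; lra.
have xy : x <= y.
  have h4 : 4 ^+ ni <= 4 ^+ n :> R by rewrite ler_weXn2l // ler1n.
  have h1 : 1 <= 4 ^+ ni :> R by rewrite exprn_ege1 // ler1n.
  have hj : nj%:R <= n%:R :> R by rewrite ler_nat.
  have hj1 : 1 <= nj%:R :> R by rewrite ler1n.
  by rewrite /x /y ler_pM //; lra.
have y0 := lt_le_trans x0 xy.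
by rewrite divr_gt0 ?sqrtr_gt0 //= ler_pM2l // lef_pV2 ?posrE ?sqrtr_gt0 // ler_wsqrtr.
Qed.

(* The estimate only needs lower bounds that depend on [n] and [rho], so the *)
(* same constant serves all partitions of [n] and all permutations [q]. *)
Definition sweep_constant (R : realType) (n : nat) (rho : R) : R :=
  n%:R ^+ 2 * (2 ^+ (n ^ 2) * (2 * (1 + 4 / (rho * gamma R n n) ^+ 2)) ^+ (n ^ 2)).

Lemma sweep_constant_ge0 (R : realType) n (rho : R) : 0 <= sweep_constant n rho.
Proof.
by rewrite !mulr_ge0 ?exprn_ge0 // mulr_ge0 // addr_ge0 // divr_ge0 // sqr_ge0.
Qed.

Lemma jacobi_sweep_bound (R : realType) m (O : seq ('I_m * 'I_m)) n
    (p : m.-tuple nat) (rho : R) (A A' : 'M[R]_(\sum_i tnth p i)) :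
  Bspg O -> 0 < rho -> is_partition n p -> A^T = A -> jacobi_sweep rho O A A' ->
  offdiag_sum A' <= sweep_constant n rho * (offdiag_sum A - offdiag_sum A').
Proof.
move=> hO rho0 [m1 p0 sump] sA hAA'.
have p_le i : (0 < tnth p i <= n)%N by rewrite p0 -sump (bigD1 i) //= leq_addr.
pose i0 : 'I_m := Ordinal (ltnW m1).
have s0_gt0 : 0 < rho * gamma R n n.
  by have /andP[h _] := gamma_min R (p_le i0) (p_le i0); rewrite mulr_gt0.
have hs i j : rho * gamma R n n <= rho * gamma R (tnth p i) (tnth p j).
  by rewrite ler_pM2l //; have /andP[] := gamma_min R (p_le i) (p_le j).
have hc := jacobi_sweep_chain s0_gt0 hs hAA'.
have g_gt0 : 0 < (rho * gamma R n n) ^+ 2 by rewrite exprn_gt0.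
have mn : (m <= n)%N.
  by rewrite -sump -[m in (m <= _)%N]card_ord -sum1_card leq_sum.
have [q [O'' [hO'' eO]]] := Bspg_relabel hO.
have hc' := chain_equiv_seq eO hc.
have [js [l [h [ol sjs full hh hl]]]] := Bsp_column_ordering hO''.
have ol' := column_ordering_map (@perm_inj _ q) ol.
(* As [m >= 2], some [j] differs from [k], and the pivot sequence contains the pair formed by [j]
   and [k]. *)
have cover k : has (fun x : 'I_m * 'I_m => (x.1 == k) || (x.2 == k)) O.
  have [/andP[_ /forallP hp] _] := hO.
  have [j nj] : exists j : 'I_m, j != k.
    have [->|] := eqVneq k i0; last by exists i0; rewrite eq_sym.
    by exists (Ordinal m1).
  apply/hasP; case: (ltngtP j k) => [jk|kj|/val_inj ejk].
  - by exists (j, k); rewrite ?eqxx ?orbT //; have /forallP/(_ k) := hp j; rewrite jk.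
  - by exists (k, j); rewrite ?eqxx ?orbT //; have /forallP/(_ j) := hp k; rewrite kj.
  - by rewrite ejk eqxx in nj.
have hl' : chain (diagonalizing_step (@tagnat.sig1 m (tnth p))
      ((rho * gamma R n n) ^+ 2)) [seq (q x.1, q x.2) | x <- l] A A' \/
    chain (diagonalizing_step (@tagnat.sig1 m (tnth p))
      ((rho * gamma R n n) ^+ 2)) (rev [seq (q x.1, q x.2) | x <- l]) A A'.
  case: hl => eO''; [left|right; rewrite -map_rev]; move: hc';
    rewrite /relabel eO'' -map_comp; apply: chain_map => x B C /=;
    by have [->|->] := hh x; case: ifP => _ //=; apply: diagonalizing_stepC.
have full' (u : 'I_(\sum_i tnth p i)) : tagnat.sig1 u \in map q js.
  by rewrite -[tagnat.sig1 u](permKV q) mem_map ?full //; apply: perm_inj.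
have := offdiag_sum_sweep g_gt0 ol' full' sA hc cover hl'.
rewrite size_map sjs (_ : (\sum_i tnth p i)%:R = n%:R :> R); last by rewrite sump.
move=> bnd; apply: (le_trans bnd).
apply: ler_wpM2r; first by rewrite subr_ge0 (offdiag_sum_chain hc).
have K1 : 1 <= 2 * (1 + 4 / (rho * gamma R n n) ^+ 2).
  have : 0 <= 4 / (rho * gamma R n n) ^+ 2 by rewrite divr_ge0 // ltW.
  by lra.
have mn2 : (m ^ 2 <= n ^ 2)%N by rewrite leq_sqr.
have K0 := le_trans ler01 K1.
apply: ler_wpM2l; first exact: exprn_ge0.
apply: ler_pM; rewrite ?exprn_ge0 //; apply: ler_weXn2l => //.
by rewrite ler1n.
Qed.

Theorem theorem3p10 (R : realType) :
  exists (eta : seq nat -> R -> R) (eta_tilde : nat -> R -> R),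
    (forall (n m : nat) (sigma : m.-tuple nat) (rho : R),
        0 < rho <= 1 -> is_partition n sigma ->
        0 <= eta sigma rho /\ eta sigma rho < eta_tilde n rho /\
        eta_tilde n rho < 1) /\
    (forall (m : nat) (O : seq ('I_m * 'I_m)), Bspg O ->
      exists q : 'S_m,
        forall (n : nat) (p : m.-tuple nat) (rho : R),
          0 < rho <= 1 -> is_partition n p ->
          (forall A A' : 'M[R]_(\sum_i tnth p i),
              A^T = A -> jacobi_sweep rho O A A' ->
              offnorm A' ^+ 2 <=
                eta (perm_partition p q) rho * offnorm A ^+ 2) /\
          0 <= eta (perm_partition p q) rho /\
          eta (perm_partition p q) rho < eta_tilde n rho /\
          eta_tilde n rho < 1).
Proof.
(* Solving [S' <= Q * (S - S')] for [S']; the strict upper bound [eta_tilde] is the midpoint between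
   this factor and 1. *)
pose eta0 n (rho : R) := sweep_constant n rho / (1 + sweep_constant n rho).
have eta0P n rho : [/\ 0 <= eta0 n rho, eta0 n rho < (1 + eta0 n rho) / 2 &
    (1 + eta0 n rho) / 2 < 1].
  have Q0 := sweep_constant_ge0 n rho.
  have Q1 : 0 < 1 + sweep_constant n rho by lra.
  have e0 : 0 <= eta0 n rho by rewrite divr_ge0 // ltW.
  have e1 : eta0 n rho < 1 by rewrite ltr_pdivrMr // mul1r; lra.
  by split=> //; lra.
exists (fun s => eta0 (sumn s)), (fun n rho => (1 + eta0 n rho) / 2).
have sumnP n m (s : m.-tuple nat) : is_partition n s -> sumn s = n.
  by move=> [_ _ <-]; rewrite sumnE big_tuple.
split=> [n m s rho _ /sumnP ->|m O hO]; first by have [] := eta0P n rho.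
(* [eta] depends on a partition through its sum, which permutations preserve, so the identity is a
   valid choice. *)
exists 1%g => n p rho /andP[rho0 _] hp.
have -> : sumn (perm_partition p 1%g) = n.
  by rewrite -(sumnP _ _ _ hp) !sumnE !big_tuple; apply: eq_bigr => i _;
    rewrite tnth_mktuple perm1.
have [e0 e1 e2] := eta0P n rho; split=> [A A' sA hA|//].
have := jacobi_sweep_bound hO rho0 hp sA hA.
have sA' : A'^T = A'.
  case: hA => X [hX0 hX <-]; rewrite -hX0 in sA.
  suff sX k : (k <= size O)%N -> (X k)^T = X k by apply: sX.
  elim: k => [//|k IH] hk; have [i [j [_ [V [_ -> _]]]]] := hX k hk.
  by rewrite !trmx_mul trmxK (IH (ltnW hk)) mulmxA.
rewrite !offdiag_sum_offnorm //.
have Q0 := sweep_constant_ge0 n rho.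
rewrite /eta0; set Q := sweep_constant n rho in Q0 *.
move=> h; rewrite mulrAC ler_pdivlMr; last by lra.
lra.
Qed.
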